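(* Let $\mathbf{b}$ be a universal combinatorial Bernoulli test, extended to infinite sequences by $\mathbf{b}(\omega)=\sup_{x\sqsubseteq\omega}\mathbf{b}(x)$, and let $\mathbf{t}_{\mathcal{B}}$ be a universal expectation-bounded Bernoulli test. Then $\mathbf{b}(\omega)\doteq\mathbf{t}_{\mathcal{B}}(\omega)$, i.e. there is $c>0$ with $c^{-1}\mathbf{t}_{\mathcal{B}}(\omega)\le\mathbf{b}(\omega)\le c\,\mathbf{t}_{\mathcal{B}}(\omega)$ for all $\omega\in\Omega=\{0,1\}^{\mathbb{N}}$.
   Context: For $p\in[0,1]$, $B_p$ is the Bernoulli measure on $\Omega$ (independent bits, each equal to 1 with probability $p$). A function $t:\Omega\to[0,+\infty]$ is lower semicomputable if for every rational $r$ the set $\{\omega:r<t(\omega)\}$ is a union of an enumerable family of intervals $x\Omega$ (sequences with prefix $x$), uniformly in $r$. An expectation-bounded Bernoulli test is a lower semicomputable $t\ge0$ on $\Omega$ with $\int t\,dB_p\le1$ for every $p\in[0,1]$; a universal one dominates every such test up to a multiplicative constant. $\mathbb{B}(n,k)$ is the set of binary words of length $n$ with exactly $k$ ones. A combinatorial Bernoulli test is a function $f:\{0,1\}^*\to[0,+\infty]$ that is lower semicomputable (the set of pairs $(x,r)$ with rational $r<f(x)$ is enumerable), monotone ($f(x)\le f(y)$ if $x$ is a prefix of $y$), and such that for all $0\le k\le n$ the average of $f$ over $\mathbb{B}(n,k)$ is at most 1. A universal combinatorial Bernoulli test is one dominating every combinatorial Bernoulli test up to a multiplicative constant (it exists).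 *)

(* Defs.v *)
From HB Require Import structures.
From mathcomp Require Import all_boot all_order all_algebra.
From mathcomp Require Import all_classical all_reals all_analysis.
From mathcomp Require Import measurable_realfun zify ring lra.
Set Implicit Arguments.
Unset Strict Implicit.
Unset Printing Implicit Defensive.
Import Order.TTheory GRing.Theory Num.Theory.
Import numFieldNormedType.Exports.
Local Open Scope classical_set_scope.
Local Open Scope ring_scope.

(** Kleene's general recursive functions: total functions, with minimization
    applied only when a zero always exists.  By the normal form theorem these
    are exactly the total computable functions. *)
Inductive recursive : forall k, (k.-tuple nat -> nat) -> Prop :=
| rec_zero k : recursive (fun _ : k.-tuple nat => 0%N)
| rec_succ : recursive (fun v : 1.-tuple nat => (thead v).+1)
| rec_proj k (i : 'I_k) : recursive (fun v : k.-tuple nat => tnth v i)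
| rec_comp k m (f : m.-tuple nat -> nat) (g : 'I_m -> k.-tuple nat -> nat) :
    recursive f -> (forall i, recursive (g i)) ->
    recursive (fun v : k.-tuple nat => f [tuple g i v | i < m])
| rec_prim k (f : k.-tuple nat -> nat) (g : k.+2.-tuple nat -> nat)
    (h : k.+1.-tuple nat -> nat) :
    recursive f -> recursive g ->
    (forall v : k.-tuple nat, h [tuple of 0%N :: v] = f v) ->
    (forall n (v : k.-tuple nat), h [tuple of n.+1 :: v] =
                 g [tuple of n :: h [tuple of n :: v] :: v]) ->
    recursive h
| rec_mu k (f : k.+1.-tuple nat -> nat) (h : k.-tuple nat -> nat) :
    recursive f ->
    (forall v : k.-tuple nat, f [tuple of h v :: v] = 0%N) ->
    (forall (v : k.-tuple nat) y, (y < h v)%N -> f [tuple of y :: v] != 0%N) ->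
    recursive h.

Definition computable (g : nat -> nat) : Prop :=
  recursive (fun v : 1.-tuple nat => g (thead v)).

(** Effective codes: Cantor pairing, bijective base 2 for words, and lowest
    terms for rationals. *)
Definition code_pair (a b : nat) : nat := ('C((a + b).+1, 2) + b)%N.

Fixpoint code_word (x : seq bool) : nat :=
  if x is b :: y then ((code_word y).*2 + b).+1 else 0%N.

Definition code_int (z : int) : nat :=
  match z with Posz n => n.*2 | Negz n => n.*2.+1 end.

Definition code_rat (r : rat) : nat :=
  code_pair (code_int (numq r)) `|denq r|%N.

Definition code (q : seq bool * rat) : nat :=
  code_pair (code_word q.1) (code_rat q.2).

Definition enumerable (A : set (seq bool * rat)) : Prop :=
  A = set0 \/ exists g : nat -> nat, computable g /\ range g = code @` A.

Definition cylinder (x : seq bool) : set (nat -> bool) :=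
  [set w | mkseq w (size x) = x].

(** [nat -> bool] with the sigma-algebra generated by the intervals. *)
Definition Omega := g_sigma_algebraType (range cylinder).

Definition is_bernoulli (R : realType) (p : R) (P : probability Omega R) :=
  forall x : seq bool,
    P (cylinder x) = (\prod_(b <- x) (if b then p else 1 - p))%:E.

Section Tests.
Variable R : realType.
Local Open Scope ereal_scope.

Definition lower_semicomputable (t : Omega -> \bar R) : Prop :=
  exists W : set (seq bool * rat), enumerable W /\
    forall r : rat,
      [set w | (ratr r)%:E < t w] = \bigcup_(x in [set x | W (x, r)]) cylinder x.

(** [is_bernoulli p P] determines [P] on measurable sets, so quantifying over [P]
    only names B_p; its existence is [bernoulli_exists] below. *)
Definition bernoulli_test (t : Omega -> \bar R) : Prop :=
  [/\ forall w, 0 <= t w,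
      lower_semicomputable t &
      forall (p : R) (P : probability Omega R), (0 <= p <= 1)%R ->
        is_bernoulli p P -> \int[P]_w t w <= 1].

Definition universal_bernoulli_test (u : Omega -> \bar R) : Prop :=
  bernoulli_test u /\
  forall t, bernoulli_test t ->
    exists c : R, (0 < c)%R /\ forall w, t w <= c%:E * u w.

Definition Bnk (n k : nat) : {set n.-tuple bool} :=
  [set x : n.-tuple bool | count_mem true x == k].

Definition combinatorial_bernoulli_test (f : seq bool -> \bar R) : Prop :=
  [/\ forall x, 0 <= f x,
      enumerable [set q | (ratr q.2)%:E < f q.1],
      forall x y, prefix x y -> f x <= f y &
      forall n k, (k <= n)%N ->
        (#|Bnk n k|%:R^-1)%:E * (\sum_(x in Bnk n k) f x) <= 1].

Definition universal_combinatorial_bernoulli_test (b : seq bool -> \bar R) :=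
  combinatorial_bernoulli_test b /\
  forall f, combinatorial_bernoulli_test f ->
    exists c : R, (0 < c)%R /\ forall x, f x <= c%:E * b x.

Definition extend (b : seq bool -> \bar R) (w : Omega) : \bar R :=
  ereal_sup [set b x | x in [set x | cylinder x w]].

End Tests.

Lemma code_pair_inj a b c d :
  code_pair a b = code_pair c d -> a = c /\ b = d.
Proof.
have T s : 'C(s.+2, 2) = ('C(s.+1, 2) + s.+1)%N.
  by rewrite binS bin1.
have mono s s' : (s < s')%N -> ('C(s.+1, 2) + s < 'C(s'.+1, 2))%N.
  elim: s' => // s' IH; rewrite ltnS leq_eqVlt => /orP[/eqP ->|/IH]; rewrite T; lia.
rewrite /code_pair => E.
have := mono (a + b)%N (c + d)%N; have := mono (c + d)%N (a + b)%N.
case: (ltngtP (a + b)%N (c + d)%N) => [|| F]; try by lia.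
by rewrite F in E; lia.
Qed.

Lemma code_inj : injective code.
Proof.
have wi : injective code_word.
  elim=> [|a x IH] [|b y] //= [E].
  have [ab xy] : a = b /\ code_word x = code_word y.
    by case: a b E => [] [] E; split => //; lia.
  by rewrite ab (IH _ xy).
have zi : injective code_int.
  by move=> [m|m] [n|n] /= E; try lia; congr (_ _); lia.
have ri : injective code_rat.
  move=> r s /code_pair_inj[/zi n_eq d_eq].
  rewrite -(divq_num_den r) -(divq_num_den s) n_eq.
  by move: d_eq (denq_gt0 r) (denq_gt0 s) => d_eq r0 s0; congr (_ / _%:~R); lia.
by move=> [x r] [y s] /code_pair_inj[/wi /= -> /ri /= ->].
Qed.

Section BernoulliExists.
Variables (R : realType) (p : R).
Hypotheses (p0 : 0 <= p) (p1 : p <= 1).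

(* Image of Lebesgue measure on [0, 1[ under successive splittings of the
   interval in proportions p : 1 - p. *)
Let step (u : R) : R := if u < p then u / p else (u - p) / (1 - p).
Let bits (u : R) : Omega := fun n => iter n step u < p.

Fixpoint bernoulli_itv (x : seq bool) : R * R :=
  if x is b :: y then
    if b then (p * (bernoulli_itv y).1, p * (bernoulli_itv y).2)
    else (p + (1 - p) * (bernoulli_itv y).1, p + (1 - p) * (bernoulli_itv y).2)
  else (0, 1).

Let lohi_len x :
  (bernoulli_itv x).2 - (bernoulli_itv x).1 = \prod_(b <- x) (if b then p else 1 - p).
Proof.
elim: x => [|[] x IH] /=; first by rewrite big_nil subr0.
- by rewrite big_cons -IH; ring.
- by rewrite big_cons -IH; ring.
Qed.

Let step01 u : 0 <= u < 1 -> 0 <= step u < 1.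
Proof.
move=> /andP[u0 u1]; rewrite /step; case: ltP => up.
  have pp : 0 < p by lra.
  by rewrite divr_ge0//= ltr_pdivrMr// mul1r.
have qq : 0 < 1 - p by lra.
rewrite divr_ge0//=; [|lra|lra]; rewrite ltr_pdivrMr// mul1r; lra.
Qed.

Let cylinder_cons b x u :
  cylinder (b :: x) (bits u) <-> (u < p) = b /\ cylinder x (bits (step u)).
Proof.
rewrite /cylinder /= /mkseq /= (iotaDl 1 0) -map_comp.
have -> : map (bits u \o addn 1) (iota 0 (size x)) =
          map (bits (step u)) (iota 0 (size x)).
  by apply: eq_map => n; rewrite /bits /= -iterS iterSr.
by split=> [[<- ->]|[<- ->]].
Qed.

Let lohi_bound x : 0 <= (bernoulli_itv x).1 /\ (bernoulli_itv x).1 <= (bernoulli_itv x).2 /\ (bernoulli_itv x).2 <= 1.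
Proof.
elim: x => [|[] x] /=; first by move=> *; split => //; lra.
- case: (bernoulli_itv x) => l h /= [l0 [lh h1]].
  by split; [|split]; move: p0 p1 => q0 q1; nra.
- case: (bernoulli_itv x) => l h /= [l0 [lh h1]].
  by split; [|split]; move: p0 p1 => q0 q1; nra.
Qed.

Let bits_lohi x u : 0 <= u < 1 ->
  cylinder x (bits u) <-> (bernoulli_itv x).1 <= u < (bernoulli_itv x).2.
Proof.
elim: x u => [|b x IH] u u01; first by rewrite /cylinder /=; split.
rewrite cylinder_cons (IH (step u)) ?step01//=.
move: (lohi_bound x) (u01); case: (bernoulli_itv x) => l h /= [l0 [lh h1]] /andP[u0 u1].
rewrite /step; case: ltP => up; case: b => /=.
- have pp : 0 < p by lra.
  rewrite ler_pdivlMr// ltr_pdivrMr// ![_ * p]mulrC.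
  by split=> [[_ ]|]; last split.
- by split=> [[]//|/andP[a b]]; exfalso; move: p0 p1 => q0 q1; nra.
- by split=> [[]//|/andP[a b]]; exfalso; move: p0 p1 => q0 q1; nra.
- have qq : 0 < 1 - p by lra.
  rewrite ler_pdivlMr// ltr_pdivrMr//.
  by split=> [[_]|] /andP[a b]; [|split=> //]; apply/andP; split; lra.
Qed.

Let measurable_step : measurable_fun [set: R] step.
Proof.
apply: measurable_fun_ifT.
- by apply: measurable_fun_ltr.
- by apply: measurable_funM.
- by apply: measurable_funM => //; apply: measurable_funB.
Qed.

Let measurable_bits : measurable_fun [set: R] bits.
Proof.
apply: (@measurability _ _ _ Omega setT bits (range cylinder)) => //= _ [_ [x _ <-] <-].
rewrite setTI; elim: x => [|b x IH].
  by rewrite [X in measurable X](_ : _ = setT)//; apply/seteqP; split.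
rewrite [X in measurable X](_ : _ =
    (fun u => u < p) @^-1` [set b] `&` step @^-1` (bits @^-1` cylinder x)).
  apply: measurableI.
    rewrite -[X in measurable X]setTI.
    by apply: measurable_fun_ltr.
  by rewrite -[X in measurable X]setTI; exact: measurable_step.
by apply/seteqP; split=> u /= /cylinder_cons.
Qed.

Lemma bernoulli_exists : exists P : probability Omega R, is_bernoulli p P.
Proof.
have mI : measurable (`[0%R, 1%R[%classic : set R) by [].
pose mu := mrestr (@lebesgue_measure R) mI.
pose P0 : {measure set Omega -> \bar R} :=
  measure_function_pushforward__canonical__measure_function_Measure
    mu measurable_bits.
have muE x : P0 (cylinder x) = (\prod_(b <- x) (if b then p else 1 - p))%:E.
  rewrite /P0 /= /pushforward /mu /mrestr.
  have [l0 [lh h1]] := lohi_bound x.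
  rewrite [X in lebesgue_measure X](_ : _ = `[(bernoulli_itv x).1, (bernoulli_itv x).2[%classic).
    rewrite lebesgue_measure_itv /= lte_fin -lohi_len; case: ltP => [//|hl].
    by congr (_%:E); lra.
  apply/seteqP; split=> u /=; rewrite !in_itv /=.
    by move=> [c u01]; apply/bits_lohi.
  move=> lu; have u01 : 0 <= u < 1 by lra.
  by split=> //; apply/bits_lohi.
have P1 : P0 setT = 1%E.
  have -> : [set: Omega] = cylinder [::] by apply/seteqP; split.
  by rewrite muE big_nil.
pose HP := Measure_isProbability.Build _ _ _ P0 P1.
pose PP : probability Omega R := HB.pack (Measure.sort P0) HP.
by exists PP => x; exact: muE.
Qed.

End BernoulliExists.

(* Main.v *)
Require Import Defs.
From HB Require Import structures.
From Stdlib Require PeanoNat.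
From mathcomp Require Import all_boot all_order all_algebra.
From mathcomp Require Import all_classical all_reals all_analysis.
From mathcomp Require Import measurable_realfun zify ring lra.
(* MathComp-Analysis also has a [code]; the one of [Defs] must win. *)
Import Defs.
Set Implicit Arguments.
Unset Strict Implicit.
Unset Printing Implicit Defensive.
Import Order.TTheory GRing.Theory Num.Theory.

(** A combinatorial test extends to a Bernoulli test because B_p is a mixture of
    the uniform measures on the sets B(n, k), and by monotone convergence.

    Conversely, write a Bernoulli test t as the supremum along prefixes of a
    monotone function T on words, and put f(x) = T(x') / 2, where x' is the prefix
    of x of length floor(sqrt |x|).  Under the uniform measure on B(N, k), a word
    of length n with n^2 <= N is a prefix with probability at most twice its
    B_(k/N)-probability (drawing without versus with replacement), so the average
    of f on B(N, k) is at most the integral of t under B_(k/N).  Since |x'| is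
    unbounded along a sequence, f still reaches t / 2.  The set of pairs (x, q)
    with q < f(x) is enumerated by searching for a witness (an index in the
    enumeration of t, a suffix, Bezout coefficients) coded by iterated pairing. *)

(** * Recursive functions *)

Definition computable2 (f : nat -> nat -> nat) : Prop :=
  recursive (fun v : 2.-tuple nat => f (tnth v ord0) (tnth v ord_max)).

Lemma eq_recursive k (f g : k.-tuple nat -> nat) :
  f =1 g -> recursive f -> recursive g.
Proof. by move=> /funext ->. Qed.

Lemma recursive_comp1 k f (g : k.-tuple nat -> nat) :
  computable f -> recursive g -> recursive (fun v => f (g v)).
Proof.
move=> rf rg.
apply: eq_recursive (rec_comp rf (fun=> rg)) => v.
by rewrite /thead tnth_mktuple.
Qed.

Lemma recursive_comp2 k f (g h : k.-tuple nat -> nat) :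
  computable2 f -> recursive g -> recursive h ->
  recursive (fun v => f (g v) (h v)).
Proof.
move=> rf rg rh.
have rgh (i : 'I_2) : recursive (if i == ord0 then g else h) by case: ifP.
by apply: eq_recursive (rec_comp rf rgh) => v; rewrite !tnth_mktuple.
Qed.

Lemma recursive_cst k n : recursive (fun _ : k.-tuple nat => n).
Proof.
elim: n => [|n IH]; first exact: rec_zero.
exact: recursive_comp1 rec_succ IH.
Qed.

Lemma computable_id : computable id.
Proof. exact: rec_proj. Qed.

Lemma computable_comp f g : computable f -> computable g -> computable (f \o g).
Proof. by move=> rf rg; exact: (recursive_comp1 rf rg). Qed.

Lemma computable2_fst : computable2 (fun a _ => a).
Proof. exact: rec_proj. Qed.

Lemma computable2_snd : computable2 (fun _ b => b).
Proof. exact: rec_proj. Qed.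

Lemma computable_comp2 f g h : computable2 f -> computable g -> computable h ->
  computable (fun n => f (g n) (h n)).
Proof. by move=> rf rg rh; exact: (recursive_comp2 rf rg rh). Qed.

Lemma computable2_comp1 f g : computable f -> computable2 g ->
  computable2 (fun a b => f (g a b)).
Proof. by move=> rf rg; exact: (recursive_comp1 rf rg). Qed.

Lemma computable2_comp2 f g h : computable2 f -> computable2 g -> computable2 h ->
  computable2 (fun a b => f (g a b) (h a b)).
Proof. by move=> rf rg rh; exact: (recursive_comp2 rf rg rh). Qed.

Lemma computable_cst n : computable (fun=> n).
Proof. exact: recursive_cst. Qed.

Lemma computable2_cst n : computable2 (fun _ _ => n).
Proof. exact: recursive_cst. Qed.

Lemma computable_succ : computable succn.
Proof. exact: rec_succ. Qed.

Lemma computable_prim h g : computable2 g ->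
  (forall n, h n.+1 = g n (h n)) -> computable h.
Proof.
move=> rg hS.
apply: (@rec_prim 0 (fun=> h 0) (fun v => g (tnth v ord0) (tnth v ord_max))).
- exact: recursive_cst.
- exact: rg.
- by [].
- by move=> n v; rewrite !(tnth_nth 0) /= hS.
Qed.

Lemma computable2_prim h f g : computable f -> computable2 g ->
  (forall b, h 0 b = f b) -> (forall a b, h a.+1 b = g (h a b) b) ->
  computable2 h.
Proof.
move=> rf rg h0 hS; pose o i (Hi : i < 3) := Ordinal Hi.
apply: (@rec_prim 1 (fun v => f (thead v))
  (fun v => g (tnth v (o 1 isT)) (tnth v (o 2 isT)))) => //.
- exact: recursive_comp2 rg (rec_proj _) (rec_proj _).
- by move=> v; rewrite !(tnth_nth 0) /= h0 /thead (tnth_nth 0).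
- by move=> n v; rewrite !(tnth_nth 0) /= hS.
Qed.

Lemma computable_mu f h : computable2 f ->
  (forall b, f (h b) b = 0) -> (forall b y, y < h b -> f y b != 0) ->
  computable h.
Proof.
move=> rf h0 hmin.
apply: (@rec_mu 1 (fun v => f (tnth v ord0) (tnth v ord_max))) => //.
- by move=> v; rewrite /thead !(tnth_nth 0) /= h0.
- by move=> v y /hmin; rewrite /thead !(tnth_nth 0).
Qed.

Lemma computable2_swap f : computable2 f -> computable2 (fun a b => f b a).
Proof.
by move=> rf; exact: computable2_comp2 rf computable2_snd computable2_fst.
Qed.

(** * Arithmetical operations *)

Lemma computable2_add : computable2 addn.
Proof.
by apply: computable2_prim computable_id
  (computable2_comp1 computable_succ computable2_fst) _ _.
Qed.

Lemma computable2_mul : computable2 muln.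
Proof.
apply: computable2_prim (computable_cst 0) computable2_add _ _ => // a b.
by rewrite mulSn addnC.
Qed.

Lemma computable_predn : computable predn.
Proof. exact: computable_prim computable2_fst _. Qed.

Lemma computable2_sub : computable2 subn.
Proof.
apply: (@computable2_swap (fun a b => b - a)).
apply: computable2_prim computable_id
  (computable2_comp1 computable_predn computable2_fst) _ _ => [b|a b] /=.
  exact: subn0.
by rewrite subnS.
Qed.

Lemma computable_bool0 : computable (fun n => n == 0 : nat).
Proof.
by apply: computable_prim (computable2_cst 0) _ => n.
Qed.

Lemma computable2_leq : computable2 (fun a b => a <= b : nat).
Proof. exact: computable2_comp1 computable_bool0 computable2_sub. Qed.

Lemma computable2_eq : computable2 (fun a b => a == b : nat).
Proof.
have := computable2_comp2 computable2_mul computable2_leq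
  (computable2_swap computable2_leq).
by congr computable2; apply/funext => a; apply/funext => b; rewrite mulnb -eqn_leq.
Qed.

Lemma computable_odd : computable (fun n => odd n : nat).
Proof.
by apply: computable_prim (computable2_comp1 computable_bool0 computable2_snd) _ =>
  n /=; case: odd.
Qed.

Lemma computable_uphalf : computable uphalf.
Proof.
(* The recursion is [uphalf n.+1 = n.+1 - uphalf n]. *)
apply: computable_prim (computable2_comp2 computable2_sub
  (computable2_comp1 computable_succ computable2_fst) computable2_snd) _ => n.
by lia.
Qed.

Lemma computable_exp2 : computable (expn 2).
Proof.
apply: computable_prim (computable2_comp2 computable2_mul (computable2_cst 2)
  computable2_snd) _ => n; exact: expnS.
Qed.

Lemma computable_bin2 : computable (fun n => 'C(n, 2)).
Proof.
by apply: computable_prim (computable2_comp2 computable2_add computable2_snd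
  computable2_fst) _ => n; rewrite binS bin1.
Qed.


(** * Inverses of the Cantor pairing *)

Fact pair_diag_ex n : exists s, n < 'C(s.+2, 2).
Proof. by exists n; rewrite binS bin1; lia. Qed.

(** The diagonal [a + b] of the pair coded by [n], given as a least witness so that minimization
    computes it. *)
Definition pair_diag n := ex_minn (pair_diag_ex n).
Definition unpair2 n := n - 'C((pair_diag n).+1, 2).
Definition unpair1 n := pair_diag n - unpair2 n.

Lemma pair_diagK a b : pair_diag (code_pair a b) = a + b.
Proof.
rewrite /pair_diag; case: ex_minnP => s; rewrite /code_pair => sP smin.
have ab : s <= a + b by apply: smin; rewrite [X in _ < X]binS bin1; lia.
apply/eqP; rewrite eqn_leq ab leqNgt; apply/negP => sab.
suff : 'C(s.+2, 2) <= 'C((a + b).+1, 2) by lia.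
exact: leq_bin2l.
Qed.

Lemma unpair2K a b : unpair2 (code_pair a b) = b.
Proof. by rewrite /unpair2 pair_diagK /code_pair addKn. Qed.

Lemma unpair1K a b : unpair1 (code_pair a b) = a.
Proof. by rewrite /unpair1 pair_diagK unpair2K addnK. Qed.

Lemma computable_pair_diag : computable pair_diag.
Proof.
(* Truncated subtraction turns the inequality [n < 'C(s.+2, 2)] into the vanishing of a recursive
   function. *)
apply: (@computable_mu (fun s n => n.+1 - 'C(s.+2, 2))).
- apply: computable2_comp2 computable2_sub _ _.
    exact: computable2_comp1 computable_succ computable2_snd.
  apply: computable2_comp1 computable_bin2 _.
  apply: computable2_comp1 computable_succ _.
  exact: computable2_comp1 computable_succ computable2_fst.
- by move=> n; rewrite /pair_diag; case: ex_minnP => s sP _; apply/eqP.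
- move=> n s; rewrite /pair_diag; case: ex_minnP => m _ mmin.
  by apply: contraTneq => /eqP/mmin; rewrite -leqNgt.
Qed.

Lemma computable_unpair2 : computable unpair2.
Proof.
apply: computable_comp2 computable2_sub computable_id _.
apply: computable_comp computable_bin2 _.
exact: computable_comp computable_succ computable_pair_diag.
Qed.

Lemma computable_unpair1 : computable unpair1.
Proof.
exact: computable_comp2 computable2_sub computable_pair_diag computable_unpair2.
Qed.

(** * Length and prefix order on codes of words *)

Lemma code_word_bounds x : 2 ^ size x <= (code_word x).+1 < 2 ^ (size x).+1.
Proof. by elim: x => //= b x; rewrite !expnS; case: b; lia. Qed.

Definition code_size n := trunc_log 2 n.+1.

Lemma code_word_size x : code_size (code_word x) = size x.
Proof.
by apply: trunc_log_eq => //; rewrite code_word_bounds.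
Qed.

Lemma computable_code_size : computable code_size.
Proof.
apply: (@computable_mu (fun l n => n.+2 - 2 ^ l.+1)).
- apply: computable2_comp2 computable2_sub _ _.
    apply: computable2_comp1 computable_succ _.
    exact: computable2_comp1 computable_succ computable2_snd.
  apply: computable2_comp1 computable_exp2 _.
  exact: computable2_comp1 computable_succ computable2_fst.
- by move=> n; apply/eqP; rewrite subn_eq0; exact: trunc_log_ltn.
- move=> n l ln; rewrite subn_eq0 -ltnNge ltnS.
  apply: (@leq_trans (2 ^ code_size n)); first by rewrite leq_exp2l.
  exact: trunc_logP.
Qed.

Lemma code_word_surj n : exists x, n = code_word x.
Proof.
elim/ltn_ind: n => -[_|n IH]; first by exists [::].
have [x nx] := IH n./2 ltac:(lia).
by exists (odd n :: x); rewrite /= -nx; lia.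
Qed.

Lemma code_word_cat x y :
  code_word (x ++ y) = code_word x + 2 ^ size x * code_word y.
Proof.
elim: x => [|b x IH] /=; first by rewrite add0n expn0 mul1n.
by rewrite IH expnS -mulnA; lia.
Qed.

Lemma code_word_inj : injective code_word.
Proof.
elim=> [|a x IH] [|b y] //= [E].
have [ab xy] : a = b /\ code_word x = code_word y.
  by case: a b E => [] [] E; split => //; lia.
by rewrite ab (IH _ xy).
Qed.

(** The first letter is the least significant digit, so a suffix adds a multiple of [2 ^ size x];
    conversely every number codes a suffix. Being a prefix thus becomes an arithmetical condition
    with one witness. *)
Lemma prefix_code_word x y : 
  prefix x y <-> exists n, code_word y = code_word x + 2 ^ size x * n.
Proof.
split=> [/prefixP[z ->]|[n]]; first by exists (code_word z); exact: code_word_cat.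
have [z ->] := code_word_surj n.
by rewrite -code_word_cat => /code_word_inj ->; exact: prefix_prefix.
Qed.

(** * Computable predicates and enumeration by search *)

Definition computable_pred (P : pred nat) : Prop := computable (fun n => P n : nat).

Lemma computable_and P Q : computable_pred P -> computable_pred Q ->
  computable_pred (fun n => P n && Q n).
Proof.
move=> rP rQ; apply: eq_recursive (computable_comp2 computable2_mul rP rQ) => v.
exact: mulnb.
Qed.

Lemma computable_neg P : computable_pred P -> computable_pred (fun n => ~~ P n).
Proof.
move=> rP; apply: eq_recursive (computable_comp computable_bool0 rP) => v.
by rewrite /=; case: (P (thead v)).
Qed.

Lemma computable_or P Q : computable_pred P -> computable_pred Q ->
  computable_pred (fun n => P n || Q n).
Proof.
move=> rP rQ; apply: eq_recursive
  (computable_neg (computable_and (computable_neg rP) (computable_neg rQ))) => v.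
by rewrite negb_and !negbK.
Qed.

Lemma computable_leq f g : computable f -> computable g ->
  computable_pred (fun n => f n <= g n).
Proof. by move=> rf rg; exact: computable_comp2 computable2_leq rf rg. Qed.

Lemma computable_eq f g : computable f -> computable g ->
  computable_pred (fun n => f n == g n).
Proof. by move=> rf rg; exact: computable_comp2 computable2_eq rf rg. Qed.

Lemma code_pair_surj n : exists a b, n = code_pair a b.
Proof.
elim: n => [|n [a [b ->]]]; first by exists 0, 0.
case: a => [|a].
  by exists b.+1, 0; rewrite /code_pair add0n !addn0 [in RHS]binS bin1; lia.
by exists a, b.+1; rewrite /code_pair addnS addSn addnS.
Qed.

Lemma enumerable_search (A : set (seq bool * rat)) (P : pred nat) h :
  computable_pred P -> computable h ->
  [set h m | m in [set m | P m]]%classic = (code @` A)%classic ->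
  enumerable A.
Proof.
move=> rP rh hA; have [->|/set0P[a Aa]] := eqVneq A set0; first by left.
(* Indices that fail the test are sent to one fixed element of [A], which makes the enumeration
   total; hence the separate case of empty [A]. *)
right; exists (fun m => P m * h m + ~~ P m * code a)%N; split.
  apply: (computable_comp2 computable2_add).
    exact: computable_comp2 computable2_mul rP rh.
  exact: computable_comp2 computable2_mul (computable_neg rP) (computable_cst _).
rewrite -hA; apply/seteqP; split=> [_ [m _ <-]|_ [m Pm <-]].
  case: (boolP (P m)) => Pm; rewrite ?mul0n ?mul1n ?addn0 ?add0n.
    by exists m.
  by rewrite hA; exists a.
by exists m => //; rewrite Pm mul1n addn0.
Qed.

Local Open Scope ring_scope.

(** * Codes of integers and rationals *)

Lemma odd_code_int z : odd (code_int z) = (z < 0).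
Proof. by case: z => n; rewrite /= ?odd_double. Qed.

Lemma uphalf_code_int z : uphalf (code_int z) = `|z|%N.
Proof. by case: z => n /=; lia. Qed.

Lemma code_int_surj n : exists z, n = code_int z.
Proof.
case: (boolP (odd n)) => on; last by exists (Posz n./2); rewrite /=; lia.
by exists (Negz n./2); rewrite /=; lia.
Qed.

(* Bezout coefficients witness that a fraction is in lowest terms, so that being
   the code of a rational becomes an existential condition. *)
Lemma code_ratP n d : (exists r, code_rat r = code_pair n d) <->
  (exists u v, d * u = uphalf n * v + 1)%N.
Proof.
split=> [[r /code_pair_inj[<- <-]]|[u [v duv]]].
  have d0 : (0 < `|denq r|)%N by have := denq_gt0 r; lia.
  have := coprime_num_den r; rewrite uphalf_code_int coprime_sym => /eqP cop.
  case: (egcdnP `|numq r|%N d0) => u v e _.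
  by exists u, v; rewrite mulnC e mulnC cop.
have [z nz] := code_int_surj n; rewrite nz uphalf_code_int in duv *.
have d0 : (0 < d)%N by case: d duv; lia.
have cop : coprime `|z| `|d%:Z|.
  rewrite /= coprime_sym /coprime -dvdn1.
  by rewrite -(dvdn_addr (m := `|z| * v)) -?duv ?dvdn_mulr ?dvdn_gcdl ?dvdn_gcdr.
exists (z%:~R / (d%:Z)%:~R).
rewrite /code_rat coprimeq_num// coprimeq_den//.
by rewrite gtr0_sg ?mul1r//; case: d d0 {duv cop}.
Qed.

(** Clear denominators. The code of a nonnegative integer is its double, so both sides merely
    double; an odd code means [r < 0], and then [2 * s < r] fails because [s >= 0]. *)
Lemma ltr_double_code (s r : rat) : 0 <= s ->
  (2 * s < r) = ~~ odd (code_int (numq r)) &&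
    (2 * code_int (numq s) * `|denq r| < code_int (numq r) * `|denq s|)%N.
Proof.
move=> s0.
have -> : (2 * s < r) = (2 * numq s * denq r < numq r * denq s).
  rewrite -[in LHS](divq_num_den s) -[in LHS](divq_num_den r) mulrA.
  have dr : 0 < (denq r)%:~R :> rat by rewrite ltr0z denq_gt0.
  have ds : 0 < (denq s)%:~R :> rat by rewrite ltr0z denq_gt0.
  rewrite ltr_pdivrMr// mulrAC ltr_pdivlMr//.
  by rewrite -[2]/((2%:Z)%:~R) -!rmorphM ltr_int.
have := denq_gt0 s; have := denq_gt0 r.
have : 0 <= numq s by rewrite numq_ge0.
rewrite odd_code_int -leNgt.
case: (numq s) => a // _; case: (numq r) => b /=; nia.
Qed.

(** This set will be the strict subgraph of [f]: the clause [q.2 < 0] reflects [f >= 0], and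
    [2 * q.2 < r] the factor one half. It is the projection of a decidable set of candidates with
    witnesses. *)
Lemma enumerable_shrink (W : set (seq bool * rat)) (g : nat -> nat) :
  computable g -> range g = (code @` W)%classic ->
  enumerable [set q | q.2 < 0 \/ exists x r,
    [/\ W (x, r), prefix x q.1, (size x * size x <= size q.1)%N & 2 * q.2 < r]].
Proof.
move=> rg gW.
pose p1 := unpair1; pose p2 := unpair2.
(* An index [m] pairs a candidate output [p1 m] with a witness. The candidate has word code [w],
   numerator code [n] and denominator [d]; [w'], [n'], [d'] are the same data for the enumerated
   element [i m] of [W]; [z] codes a suffix, and [u], [v] are Bezout coefficients. *)
pose w m := p1 (p1 m).
pose n m := p1 (p2 (p1 m)).
pose d m := p2 (p2 (p1 m)).
pose i m := g (p1 (p2 m)).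
pose w' m := p1 (i m).
pose n' m := p1 (p2 (i m)).
pose d' m := p2 (p2 (i m)).
pose z m := p1 (p2 (p2 m)).
pose u m := p1 (p2 (p2 (p2 m))).
pose v m := p2 (p2 (p2 (p2 m))).
pose Q m := (d m * u m == uphalf (n m) * v m + 1)%N.
pose S m := [&& ~~ odd (n' m), (2 * n m * d' m < n' m * d m)%N,
  w m == (w' m + 2 ^ code_size (w' m) * z m)%N &
  (code_size (w' m) * code_size (w' m) <= code_size (w m))%N].
have r1 f : computable f -> computable (p1 \o f).
  exact: computable_comp computable_unpair1.
have r2 f : computable f -> computable (p2 \o f).
  exact: computable_comp computable_unpair2.
have rs f : computable f -> computable (code_size \o f).
  exact: computable_comp computable_code_size.
have rM f h : computable f -> computable h -> computable (fun m => f m * h m)%N.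
  exact: computable_comp2 computable2_mul.
have rD f h : computable f -> computable h -> computable (fun m => f m + h m)%N.
  exact: computable_comp2 computable2_add.
have ri : computable i.
  by apply: computable_comp rg _; do ?[exact: computable_id|apply: (r1)|apply: (r2)].
have rw : computable w by do 2 apply: (r1); exact: computable_id.
have rn : computable n by apply: (r1); apply: (r2); apply: (r1); exact: computable_id.
have rd : computable d by apply: (r2); apply: (r2); apply: (r1); exact: computable_id.
have rw' : computable w' by exact: r1.
have rn' : computable n' by apply: (r1); exact: r2.
have rd' : computable d' by apply: (r2); exact: r2.
have rz : computable z by apply: (r1); do 2 apply: (r2); exact: computable_id.
have ru : computable u by apply: (r1); do 3 apply: (r2); exact: computable_id.
have rv : computable v by do 4 apply: (r2); exact: computable_id.
have rQ : computable_pred Q.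
  apply: computable_eq (rM _ _ rd ru) (rD _ _ _ (computable_cst 1)).
  by apply: (rM) => //; exact: computable_comp computable_uphalf rn.
have rS : computable_pred S.
  apply: computable_and.
    by apply: computable_neg; exact: computable_comp computable_odd rn'.
  apply: computable_and.
    apply: computable_leq; last exact: rM.
    apply: computable_comp computable_succ _.
    by apply: (rM) => //; apply: (rM) => //; exact: computable_cst.
  apply: computable_and.
    apply: computable_eq => //; apply: (rD) => //; apply: (rM) => //.
    by apply: computable_comp computable_exp2 _; exact: rs.
  by apply: computable_leq; [apply: (rM); exact: rs | exact: rs].
apply: (@enumerable_search _ (fun m => Q m && (odd (n m) || S m)) p1).
- apply: computable_and rQ _; apply: computable_or rS.
  exact: computable_comp computable_odd rn.
- exact: computable_unpair1.
apply/seteqP; split=> [_ [m /andP[/eqP Qm nS] <-]|].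
- have [s sE] : exists s, code_rat s = code_pair (n m) (d m).
    by apply/code_ratP; exists (u m), (v m).
  have [y yE] := code_word_surj (w m).
  have cE : code (y, s) = p1 m.
    rewrite /code /= sE -yE /w /n /d.
    have [a [c ->]] := code_pair_surj (p1 m); rewrite /p2 /p1 unpair1K unpair2K.
    by have [e [f ->]] := code_pair_surj c; rewrite unpair1K unpair2K.
  exists (y, s) => //=; have [s0|s0] := ltrP s 0; [by left | right].
  have := sE; rewrite /code_rat => /code_pair_inj[nE dE].
  move: nS; rewrite -nE odd_code_int numq_lt0 ltNge s0 /=.
  (* Values of [g] are genuine codes of elements of [W], so only the candidate carries a Bezout
     certificate. *)
  have [[x r] Wxr iE] : (code @` W)%classic (i m) by rewrite -gW; exists (p1 (p2 m)).
  rewrite /S /w' /n' /d' -iE /code /code_rat /p1 /p2 /= !(unpair1K, unpair2K).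
  rewrite yE -nE -dE !code_word_size => /and4P[on nd /eqP yx sz].
  exists x, r; split=> //; first by apply/prefix_code_word; exists (z m).
  by rewrite ltr_double_code// on.
- move=> _ [[y s] /= ysA <-].
  have [u0 [v0 uv]] : exists u v, (`|denq s| * u = uphalf (code_int (numq s)) * v + 1)%N.
    by apply/code_ratP; exists s.
  have [s0|s0] := ltrP s 0.
    (* For a negative rational the Bezout coefficients suffice; the other fields are filled with
       0. *)
    pose m := code_pair (code (y, s)) (code_pair 0 (code_pair 0 (code_pair u0 v0))).
    exists m; rewrite /= /Q /S /d /u /n /v /m /p1 /p2 /code /code_rat /=
      !(unpair1K, unpair2K)//.
    by rewrite uv eqxx /= odd_code_int numq_lt0 s0.
  case: ysA => [|[x [r [Wxr xy sz sr]]]]; first by rewrite ltNge s0.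
  have [j _ jE] : range g (code (x, r)) by rewrite gW; exists (x, r).
  have [z0 zE] := (prefix_code_word x y).1 xy.
  pose m := code_pair (code (y, s)) (code_pair j (code_pair z0 (code_pair u0 v0))).
  exists m; last by rewrite /m /p1 unpair1K.
  rewrite /= /Q /S /w /w' /n' /d' /z /d /u /n /v /i /m /p1 /p2 /code /code_rat /=.
  rewrite !(unpair1K, unpair2K) jE !(unpair1K, unpair2K) uv eqxx /=.
  rewrite !code_word_size zE eqxx sz.
  by move: sr; rewrite ltr_double_code// => /andP[-> ->]; rewrite orbT.
Qed.

Local Close Scope ring_scope.

(** * Sampling without replacement *)

(** Dividing by ['C(N, k) * N ^_ (j + i)], when it is nonzero, gives the probability that a uniform
    element of [B(N, k)] has a given prefix with [j] ones and [i] zeros: letters are drawn without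
    replacement. The induction removes the ones, then the zeros. *)
Lemma mul_bin_ffact N k j i : j <= k ->
  'C(N - (j + i), k - j) * N ^_ (j + i) = 'C(N, k) * k ^_ j * (N - k) ^_ i.
Proof.
elim: j N k => [|j IH] N k jk; last first.
  case: k jk => // k jk; rewrite addSn ffactnS subSS mulnCA.
  have -> : N - (j + i).+1 = N.-1 - (j + i) by lia.
  rewrite IH// (_ : N.-1 - k = N - k.+1); last by lia.
  by rewrite ffactSS !mulnA mul_bin_diag (mulnC k.+1).
rewrite add0n subn0 ffactn0 muln1.
elim: i N => [|i IH'] N; first by rewrite subn0 !ffactn0.
rewrite ffactnS mulnCA (_ : N - i.+1 = N.-1 - i); last by lia.
rewrite IH' mulnA mul_bin_down ffactnS (_ : N.-1 - k = (N - k).-1); last by lia.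
by rewrite mulnCA mulnA.
Qed.

Lemma ffact_le_exp n m : n ^_ m <= n ^ m.
Proof.
by elim: m => // m IH; rewrite ffactnSr expnSr leq_mul// leq_subr.
Qed.

(** Among the [N ^ n] sequences of draws, those with a repetition number at most
    ['C(n, 2) * N ^ n.-1], which is at most half of all when [n * n <= N]. [key] is this bound
    multiplied by [N], which avoids the predecessor. *)
Lemma exp_le_double_ffact N n : n * n <= N -> N ^ n <= 2 * N ^_ n.
Proof.
have key m : N ^ m * N <= N ^_ m * N + 'C(m, 2) * N ^ m.
  elim: m => [|m IH]; first by rewrite ffactn0 expn0; lia.
  have := ffact_le_exp N m.
  rewrite ffactnSr binS bin1 expnSr.
  move: (N ^ m) (N ^_ m) ('C(m, 2)) IH => a b c IH ba.
  have [Nm|mN] := leqP N m; first by nia.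
  have -> : b * (N - m) = b * N - m * b by rewrite mulnBr (mulnC m).
  nia.
case: n => // n nN; have N0 : 0 < N by lia.
rewrite -(leq_pmul2r N0); have := key n.+1.
have : 2 * 'C(n.+1, 2) <= N by have := mul_bin_diag n.+1 1; rewrite bin1; nia.
by move: (N ^ n.+1) => a; nia.
Qed.

(** The numerators only grow when falling factorials become powers; passing from the denominator
    [N ^_ n] to [N ^ n] costs the factor 2. *)
Lemma bin_prefix_le N n k j : j <= n -> j <= k -> n * n <= N ->
  'C(N - n, k - j) * N ^ n <= 2 * 'C(N, k) * (k ^ j * (N - k) ^ (n - j)).
Proof.
move=> jn jk nN.
apply: (@leq_trans ('C(N - n, k - j) * (2 * N ^_ n))).
  by rewrite leq_mul2l exp_le_double_ffact ?orbT.
have := mul_bin_ffact N (n - j) jk; rewrite subnKC// => E.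
rewrite mulnCA E -!mulnA !leq_mul2l /= ; apply/orP; right.
by rewrite leq_mul ?ffact_le_exp.
Qed.

Lemma card_Bnk n k : #|Bnk n k| = 'C(n, k).
Proof.
rewrite -[n in RHS]card_ord -card_draws.
pose f (x : n.-tuple bool) := [set i | tnth x i].
have finj : injective f.
  move=> x y /setP E; apply: eq_from_tnth => i.
  by have := E i; rewrite !inE.
rewrite -(card_imset _ finj); apply: eq_card => A; rewrite inE.
have cf x : #|f x| = count_mem true x.
  rewrite cardsE -sum1_card -[in RHS](map_tnth_enum x) count_map -sum1_count.
  by rewrite big_enum_cond; apply: eq_bigl => i /=; rewrite eqb_id.
apply/imsetP/idP => [[x]|/eqP Ak]; first by rewrite inE => /eqP xk ->; rewrite cf xk.
have fA : f [tuple i \in A | i < n] = A.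
  by apply/setP => i; rewrite inE tnth_mktuple.
by exists [tuple i \in A | i < n] => //; rewrite inE -cf fA Ak.
Qed.

(** A word of [B(N, k)] with prefix [y] is determined by its other [N - n] letters, of which [k - j]
    are ones. The factor [j <= k] guards against the truncated difference, as a binomial with lower
    index 0 is 1. *)
Lemma card_Bnk_prefix N n k (y : n.-tuple bool) : n <= N ->
  let j := count_mem true y in
  #|[set x in Bnk N k | take n x == y]| <= (j <= k) * 'C(N - n, k - j).
Proof.
move=> nN /=; set j := count_mem _ _.
have jE (x : N.-tuple bool) : x \in [set x in Bnk N k | take n x == y] ->
    (j + count_mem true (drop n x) == k) /\ take n x = y.
  rewrite !inE => /andP[/eqP xk /eqP xy]; split=> //.
  by rewrite -xk -[X in _ == count_mem _ X](cat_take_drop n) count_cat xy.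
case: (leqP j k) => jk; last first.
  rewrite /= mul0n leqn0 cards_eq0; apply/eqP/setP => x; rewrite finset.in_set0.
  by apply/negP => /jE[/eqP]; lia.
rewrite /= mul1n -card_Bnk.
rewrite -(card_in_imset (f := fun x : N.-tuple bool => [tuple of drop n x])); last first.
  move=> x x' /jE[_ xy] /jE[_ x'y] /(congr1 val) /= E; apply: val_inj => /=.
  by rewrite -(cat_take_drop n x) -(cat_take_drop n x') xy x'y E.
apply/subset_leq_card/fintype.subsetP => _ /imsetP[x /jE[/eqP xk _] ->].
by rewrite inE /= -xk addKn.
Qed.

Local Open Scope classical_set_scope.
Local Open Scope ring_scope.

(** * Bernoulli integrals *)

Section BernoulliIntegral.
Variable R : realType.
Implicit Types (p : R) (P : probability Omega R) (F : seq bool -> \bar R).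

Definition bernoulli_weight p (x : seq bool) : R :=
  \prod_(b <- x) (if b then p else 1 - p).

Lemma bernoulli_weightE p x : bernoulli_weight p x =
  p ^+ count_mem true x * (1 - p) ^+ (size x - count_mem true x).
Proof.
rewrite /bernoulli_weight; elim: x => [|b x IH]; first by rewrite big_nil mulr1.
rewrite big_cons {}IH; case: b => /=; first by rewrite add1n subSS exprS mulrA.
by rewrite add0n subSn ?count_size// exprS mulrCA.
Qed.

Lemma bernoulli_weight_ge0 p x : 0 <= p <= 1 -> 0 <= bernoulli_weight p x.
Proof.
by move=> /andP[p0 p1]; apply: prodr_ge0 => -[]; rewrite ?subr_ge0.
Qed.

Lemma measurable_cylinder x : measurable (cylinder x : set Omega).
Proof. by apply: sub_sigma_algebra; exists x. Qed.

Lemma bigsetU_cylinder n :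
  \big[setU/set0]_(x : n.-tuple bool) (cylinder x : set Omega) = setT.
Proof.
apply/seteqP; split=> // w _; rewrite -bigcup_seq.
exists [tuple w i | i < n]; first by rewrite /= mem_index_enum.
rewrite /cylinder /= size_map size_enum_ord.
by rewrite /mkseq -val_enum_ord -map_comp.
Qed.

Lemma measurable_prefix F n :
  measurable_fun setT (fun w : Omega => F (mkseq w n)).
Proof.
move=> _ B _; rewrite setTI.
rewrite [X in measurable X](_ : _ =
  \bigcup_(x in [set x : n.-tuple bool | B (F x)]) cylinder x).
  by apply: fin_bigcup_measurable => [|x _]; [exact: finite_finset|exact: measurable_cylinder].
apply/seteqP; split=> w /=.
  have sz : size (mkseq w n) == n by rewrite size_mkseq.
  by exists (Tuple sz) => //; rewrite /cylinder /= size_mkseq.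
by move=> [x /= BFx]; rewrite /cylinder /= size_tuple => ->.
Qed.

Local Open Scope ereal_scope.

(** The integrand is constant on each of the finitely many cylinders of words of length [n], which
    partition the space. *)
Lemma integral_prefix p P F n : is_bernoulli p P -> (forall x, 0 <= F x) ->
  \int[P]_w F (mkseq w n) =
  \sum_(x : n.-tuple bool) F x * (bernoulli_weight p x)%:E.
Proof.
move=> Pp F0; rewrite -(bigsetU_cylinder n) ge0_integral_bigsetU//.
- apply: eq_bigr => x _; rewrite -Pp -integral_cst; last exact: measurable_cylinder.
  apply: eq_integral => w; rewrite inE /cylinder /= size_tuple => -> //.
- by move=> x; exact: measurable_cylinder.
- exact: index_enum_uniq.
- move=> x y _ _ [w []]; rewrite /cylinder /= !size_tuple => wx wy.
  by apply: val_inj; rewrite /= -wx -wy.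
- by rewrite bigsetU_cylinder; exact: measurable_prefix.
Qed.

Lemma sum_bernoulli_weight p P n : is_bernoulli p P ->
  \sum_(x : n.-tuple bool) (bernoulli_weight p x)%:E = 1.
Proof.
move=> Pp; transitivity (\int[P]_w (cst 1 (mkseq (w : Omega) n))).
  by rewrite (integral_prefix n Pp)//; apply: eq_bigr => x _; rewrite mul1e.
by rewrite integral_cst//= mul1e probability_setT.
Qed.

(** The weight of a word depends only on its number of ones; grouping by this number exhibits [B_p]
    on words of length [n] as a mixture of the uniform measures on the sets [B(n, k)]. *)
Lemma sum_weight_Bnk p F n : (forall x, 0 <= F x) ->
  \sum_(x : n.-tuple bool) F x * (bernoulli_weight p x)%:E =
  \sum_(k < n.+1) (\sum_(x in Bnk n k) F x) * (p ^+ k * (1 - p) ^+ (n - k))%:E.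
Proof.
move=> F0.
rewrite (partition_big
  (fun x : n.-tuple bool => inord (count_mem true x) : 'I_n.+1) xpredT) //=.
apply: eq_bigr => k _; rewrite ge0_sume_distrl//.
have xkE (x : n.-tuple bool) : (inord (count_mem true x) == k :> 'I_n.+1) = (x \in Bnk n k).
  rewrite inE -val_eqE /= inordK// ltnS.
  by rewrite -[X in (_ <= X)%N](size_tuple x) count_size.
apply: eq_big => [x|x]; rewrite xkE//.
by rewrite inE => /eqP xk; rewrite bernoulli_weightE xk size_tuple.
Qed.

(** * Extension from words to sequences *)

Lemma extendE F w : extend F w = ereal_sup (range (fun n => F (mkseq w n))).
Proof.
congr ereal_sup; apply/seteqP; split=> [_ [x /= xw <-]|_ [n _ <-]].
  by exists (size x) => //; rewrite xw.
by exists (mkseq w n) => //=; rewrite /cylinder /= size_mkseq.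
Qed.

Lemma prefix_mkseq (w : Omega) m n : (m <= n)%N -> prefix (mkseq w m) (mkseq w n).
Proof.
move=> mn; rewrite prefixE size_mkseq.
by rewrite /mkseq -map_take take_iota (minn_idPl mn).
Qed.

Lemma extend_ge0 F w : (forall x, 0 <= F x) -> 0 <= extend F w.
Proof.
move=> F0; rewrite extendE; apply: le_ereal_sup_tmp.
by exists (F (mkseq w 0)).
Qed.

Lemma le_extend F w n : F (mkseq w n) <= extend F w.
Proof. by rewrite extendE; apply: ereal_sup_ubound; exists n. Qed.

Lemma cvg_extend F w : (forall x y, prefix x y -> F x <= F y) ->
  F (mkseq w n) @[n --> \oo] --> extend F w.
Proof.
move=> Fm; rewrite extendE; apply: ereal_nondecreasing_cvgn => m n mn.
by apply: Fm; exact: prefix_mkseq.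
Qed.

Lemma measurable_extend F : (forall x y, prefix x y -> F x <= F y) ->
  measurable_fun setT (extend F).
Proof.
move=> Fm; apply: (emeasurable_fun_cvg (fun n (w : Omega) => F (mkseq w n))).
  by move=> n; exact: measurable_prefix.
by move=> w _; exact: cvg_extend.
Qed.

Lemma integral_extend_le P F M : (forall x, 0 <= F x) ->
  (forall x y, prefix x y -> F x <= F y) ->
  (forall n, \int[P]_w F (mkseq w n) <= M) -> \int[P]_w extend F w <= M.
Proof.
move=> F0 Fm FM.
have -> : \int[P]_w extend F w = \int[P]_w limn (fun n => F (mkseq w n)).
  by apply: eq_integral => w _; apply/esym/cvg_lim => //; exact: cvg_extend.
rewrite monotone_convergence//.
- apply: lime_le; last exact: nearW.
  apply: ereal_nondecreasing_is_cvgn => m n mn; apply: ge0_le_integral => //;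
    do ?exact: measurable_prefix.
  by move=> w _; apply: Fm; exact: prefix_mkseq.
- by move=> n; exact: measurable_prefix.
- by move=> w _ m n mn; apply: Fm; exact: prefix_mkseq.
Qed.

Lemma extend_bernoulli_test (b : seq bool -> \bar R) :
  combinatorial_bernoulli_test b -> bernoulli_test (extend b).
Proof.
move=> [b0 enum bm bavg]; split.
- by move=> w; exact: extend_ge0.
(* The strict subgraph of [b] serves as the enumerable family: a supremum exceeds [r] exactly when
   the value at some prefix does. *)
- exists [set q | (ratr q.2)%:E < b q.1]; split=> // r.
  apply/seteqP; split=> w /=.
    by move=> /ereal_sup_gt[_ [x xw <-] rx]; exists x.
  move=> [x /= rx xw]; apply: (lt_le_trans rx).
  by apply: ereal_sup_ubound; exists x.
- move=> p P p01 Pp; apply: integral_extend_le => // n.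
  rewrite (integral_prefix n Pp)// sum_weight_Bnk//.
  (* The bound 1 is written as the same mixture for the constant function 1, so that the sums
     compare term by term in [k]. *)
  rewrite -(sum_bernoulli_weight n Pp).
  have -> : \sum_(x : n.-tuple bool) (bernoulli_weight p x)%:E =
      \sum_(x : n.-tuple bool) cst 1 (val x) * (bernoulli_weight p x)%:E.
    by apply: eq_bigr => x _; rewrite mul1e.
  rewrite sum_weight_Bnk//.
  apply: lee_sum => k _; apply: lee_wpmul2r.
    rewrite lee_fin; case/andP: p01 => p0 p1.
    by rewrite mulr_ge0// exprn_ge0// subr_ge0.
  have kn : (k <= n)%N by rewrite -ltnS.
  have card0 : (0 < #|Bnk n k|%:R :> R)%R by rewrite ltr0n card_Bnk bin_gt0.
  have := bavg n k kn; rewrite lee_pdivrMl// mule1 => /le_trans; apply.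
  by rewrite sumEFin lee_fin sumr_const.
Qed.

End BernoulliIntegral.

(** * From Bernoulli tests to combinatorial tests *)

Lemma leq_sqrt m n : (m <= Nat.sqrt n)%N = (m * m <= n)%N.
Proof. by apply/idP/idP => /ssrnat.leP/PeanoNat.Nat.sqrt_le_square/ssrnat.leP. Qed.

Lemma prefix_takeE (T : eqType) (y x : seq T) m :
  prefix y (take m x) = prefix y x && (size y <= m)%N.
Proof.
rewrite !prefixE; case: (leqP (size y) m) => ym; rewrite ?andbT ?andbF.
  by rewrite take_takel.
apply/negbTE/eqP => E; have := congr1 size E.
by rewrite !size_take_min; lia.
Qed.

Section CombinatorialTest.
Variable R : realType.
Implicit Types (F : seq bool -> \bar R) (t : Omega -> \bar R).

Lemma natr_ratio_itv (k N : nat) : (k <= N)%N -> 0 <= (k%:R / N%:R : R) <= 1.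
Proof.
move=> kN; rewrite divr_ge0//=; have [->|N0] := posnP N; first by rewrite invr0 mulr0.
by rewrite ler_pdivrMr ?ltr0n// mul1r ler_nat.
Qed.

(** [bin_prefix_le] in terms of probabilities; the parameter is the frequency of ones in the words
    of [B(N, k)]. *)
Lemma card_prefix_le_weight N n k (y : n.-tuple bool) :
  (n * n <= N)%N -> (k <= N)%N ->
  #|[set x in Bnk N k | take n x == y]|%:R <=
  2 * #|Bnk N k|%:R * bernoulli_weight (k%:R / N%:R) y :> R.
Proof.
move=> nN kN; rewrite card_Bnk.
have nleN : (n <= N)%N by nia.
have := card_Bnk_prefix k y nleN => /=; set j := count_mem _ _ => cle.
have jn : (j <= n)%N by rewrite -[X in (_ <= X)%N](size_tuple y) count_size.
have w0 : 0 <= bernoulli_weight (k%:R / N%:R) y :> R.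
  by apply: bernoulli_weight_ge0; exact: natr_ratio_itv.
apply: (@le_trans _ _ ((j <= k)%N * 'C(N - n, k - j))%:R); first by rewrite ler_nat.
case: (leqP j k) => jk /=; last by rewrite mul0n !mulr_ge0.
(* If [N = 0], the quotient [k / N] takes the default value 0; the prefix is then empty and has
   weight 1. *)
have [N0|N0] := posnP N.
  have n0 : n = 0%N by lia.
  rewrite n0 in y j cle jn jk w0 *; have j0 : j = 0%N by lia.
  rewrite bernoulli_weightE size_tuple -/j j0 subn0 !expr0 !mulr1 mul1n subn0.
  by rewrite -natrM ler_nat; lia.
have N0' : (N%:R : R) != 0 by rewrite pnatr_eq0 -lt0n.
have -> : bernoulli_weight (k%:R / N%:R) y =
    (k ^ j * (N - k) ^ (n - j))%:R / (N ^ n)%:R :> R.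
  rewrite bernoulli_weightE size_tuple -/j.
  have -> : 1 - k%:R / N%:R = (N - k)%:R / N%:R :> R by rewrite natrB//; field.
  rewrite !expr_div_n -[in (N ^ n)%N](subnKC jn) expnD !natrM !natrX.
  by field; rewrite !expf_neq0.
rewrite mulrA ler_pdivlMr ?ltr0n ?expn_gt0 ?N0// mul1n.
rewrite -!natrM ler_nat; exact: bin_prefix_le.
Qed.

Local Open Scope ereal_scope.

Lemma sum_Bnk_prefix_le N n k F : (n * n <= N)%N -> (k <= N)%N ->
  (forall x, 0 <= F x) ->
  \sum_(x in Bnk N k) F (take n x) <= (2 * #|Bnk N k|%:R)%:E *
    \sum_(y : n.-tuple bool) F y * (bernoulli_weight (k%:R / N%:R) y)%:E.
Proof.
move=> nN kN F0; have nleN : (n <= N)%N by nia.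
have -> : \sum_(x in Bnk N k) F (take n x) =
    \sum_(x in Bnk N k) \sum_(y : n.-tuple bool | take n x == y) F y.
  apply: eq_bigr => x _.
  have sz : size (take n x) == n by rewrite size_takel// size_tuple.
  by rewrite (big_pred1 (Tuple sz)).
rewrite (exchange_big_dep xpredT)//= ge0_sume_distrr; last first.
  move=> y _; rewrite mule_ge0// lee_fin bernoulli_weight_ge0//.
  exact: natr_ratio_itv.
apply: lee_sum => y _; rewrite muleCA -EFinM.
rewrite (eq_bigl (mem [set x in Bnk N k | take n x == y]%SET)); last first.
  by move=> x; rewrite !inE.
under eq_bigr do rewrite -[F y]mule1.
rewrite -ge0_sume_distrr// sumEFin sumr_const.
apply: lee_wpmul2l => //; rewrite lee_fin.
exact: card_prefix_le_weight.
Qed.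

(** The best lower bound for a test that [W] certifies on prefixes of [x]. Using all prefixes makes
    it monotone, and the adjoined 0 makes it nonnegative. *)
Definition word_sup (W : set (seq bool * rat)) (x : seq bool) : \bar R :=
  ereal_sup ([set 0] `|`
    [set (ratr r)%:E | r in [set r | exists2 y, prefix y x & W (y, r)]]).

Lemma word_sup_ge0 W x : 0 <= word_sup W x.
Proof. by apply: ereal_sup_ubound; left. Qed.

Lemma word_sup_prefix W x y : prefix x y -> word_sup W x <= word_sup W y.
Proof.
move=> xy; apply: ge_ereal_sup => _ [->|[r [z zx Wz] <-]].
  exact: word_sup_ge0.
apply: ereal_sup_ubound; right; exists r => //; exists z => //.
exact: prefix_trans xy.
Qed.

Lemma ereal_ltrat (a b : \bar R) : 0 <= a -> a < b ->
  exists r : rat, a < (ratr r)%:E < b.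
Proof.
case: a => [a||]; case: b => [b||]//= _ ab.
  by have [r] := rat_in_itvoo ab; rewrite in_itv /= => /andP[ar rb]; exists r; rewrite !lte_fin ar.
have /rat_in_itvoo[r] : (a < a + 1)%R by rewrite ltrDl.
by rewrite in_itv /= => /andP[ar _]; exists r; rewrite lte_fin ar ltry.
Qed.

Lemma extend_word_sup t W : (forall w, 0 <= t w) ->
  (forall r : rat, [set w | (ratr r)%:E < t w] =
    \bigcup_(x in [set x | W (x, r)]) cylinder x) ->
  extend (word_sup W) = t.
Proof.
move=> t0 tW; apply/funext => w; apply/eqP; rewrite eq_le; apply/andP; split.
  rewrite extendE; apply: ge_ereal_sup => _ [n _ <-].
  apply: ge_ereal_sup => _ [->//|[r [y yw Wy] <-]].
  suff : [set w | (ratr r)%:E < t w] w by move=> /ltW.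
  rewrite tW; exists y => //; move: yw; rewrite prefixE => /eqP yw.
  have : (size y <= n)%N.
    by have := congr1 size yw; rewrite size_take_min size_mkseq; lia.
  rewrite /cylinder /= => yn; rewrite -[RHS]yw.
  by rewrite /mkseq -map_take take_iota (minn_idPl yn).
rewrite leNgt; apply/negP => /ereal_ltrat[|r /andP[er rt]].
  by apply: extend_ge0; exact: word_sup_ge0.
have : [set w | (ratr r)%:E < t w] w by [].
rewrite tW => -[y /= Wy yw]; move: er; rewrite ltNge => /negP; apply.
apply: le_trans (le_extend _ w (size y)); rewrite yw.
by apply: ereal_sup_ubound; right; exists r => //; exists y => //; exact: prefix_refl.
Qed.

Lemma combinatorial_of_bernoulli_test t : bernoulli_test t ->
  exists f, combinatorial_bernoulli_test f /\ forall w, t w <= 2%:E * extend f w.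
Proof.
move=> [t0 [W [We tW]] t1].
have tE := extend_word_sup t0 tW.
have [g [rg gW]] : exists g, computable g /\ range g = code @` W.
  case: We => // W0; exfalso.
  (* [W] is nonempty because [t] exceeds -1 everywhere. *)
  have : [set w | (ratr (-1)%R)%:E < t w] (fun=> true).
    by apply: lt_le_trans (t0 _); rewrite lte_fin rmorphN1 ltrN10.
  by rewrite tW W0 => -[].
pose T := word_sup W.
(* The half absorbs the factor 2 of [sum_Bnk_prefix_le]; the square root secures its hypothesis
   [n * n <= N]. *)
pose f x : \bar R := (2^-1)%:E * T (take (Nat.sqrt (size x)) x).
exists f; split; last first.
  move=> w; rewrite -[in leLHS]tE extendE; apply: ge_ereal_sup => _ [n _ <-].
  (* On the prefix of length [n * n], [f] reads exactly the first [n] letters. *)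
  rewrite -lee_pdivrMl//; apply: le_trans (le_extend _ w (n * n)).
  rewrite /f size_mkseq; apply: lee_wpmul2l; first by rewrite lee_fin.
  apply: word_sup_prefix; rewrite prefix_takeE size_mkseq leq_sqrt leqnn andbT.
  by apply: prefix_mkseq; nia.
split.
- by move=> x; rewrite mule_ge0 ?lee_fin// word_sup_ge0.
- rewrite [X in enumerable X](_ : _ = [set q | (q.2 < 0)%R \/ exists x r,
    [/\ W (x, r), prefix x q.1, (size x * size x <= size q.1)%N & (2 * q.2 < r)%R]]).
    exact: enumerable_shrink rg gW.
  have double_lt (q r : rat) : (2%:E * (ratr q)%:E < (ratr r)%:E :> \bar R) = (2 * q < r)%R.
    by rewrite -EFinM lte_fin -(ltr_rat R) rmorphM /= rmorph_nat.
  have double_lt0 (q : rat) : (2%:E * (ratr q)%:E < 0 :> \bar R) = (q < 0)%R.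
    by rewrite -EFinM lte_fin pmulr_rlt0// ltrq0.
  apply/seteqP; split=> -[x q] /=; rewrite /f lte_pdivlMl//.
    move=> /ereal_sup_gt[_ [->|[r [y yx Wy] <-]]].
      by rewrite double_lt0; left.
    rewrite double_lt => qr; right; exists y, r.
    by move: yx; rewrite prefix_takeE leq_sqrt => /andP[].
  move=> [q0|[y [r [Wy yx ys qr]]]]; apply/ereal_sup_gtP.
    by exists 0; [left|rewrite double_lt0].
  exists (ratr r)%:E; last by rewrite double_lt.
  by right; exists r => //; exists y => //; rewrite prefix_takeE yx leq_sqrt.
- move=> x y xy; apply: lee_wpmul2l; first by rewrite lee_fin.
  apply: word_sup_prefix; rewrite prefix_takeE.
  rewrite (prefix_trans _ xy) ?prefix_take//= leq_sqrt size_take_min.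
  apply: leq_trans (size_prefix xy).
  apply: (@leq_trans (Nat.sqrt (size x) * Nat.sqrt (size x))); last by rewrite -leq_sqrt.
  by rewrite leq_mul// geq_minl.
- move=> N k kN.
  have card0 : (0 < #|Bnk N k|%:R :> R)%R by rewrite ltr0n card_Bnk bin_gt0.
  rewrite lee_pdivrMl// mule1.
  pose n := Nat.sqrt N; pose p : R := (k%:R / N%:R)%R.
  have nN : (n * n <= N)%N by rewrite -leq_sqrt.
  have p01 : (0 <= p <= 1)%R.
    exact: natr_ratio_itv.
  have [P Pp] := bernoulli_exists (andP p01).1 (andP p01).2.
  (* The sum is the integral of [T] over prefixes of length [n], and [T] stays below its supremum
     [t] along each sequence. *)
  have int1 : \sum_(y : n.-tuple bool) T y * (bernoulli_weight p y)%:E <= 1.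
    rewrite -(integral_prefix n Pp); last exact: word_sup_ge0.
    apply: le_trans (t1 p P p01 Pp); rewrite -tE; apply: ge0_le_integral => //.
    + by move=> w _; exact: word_sup_ge0.
    + exact: measurable_prefix.
    + by apply: measurable_extend; exact: word_sup_prefix.
    + by move=> w _; exact: le_extend.
  under eq_bigr do rewrite /f size_tuple.
  rewrite -ge0_sume_distrr; last by move=> *; exact: word_sup_ge0.
  rewrite lee_pdivrMl// -EFinM.
  apply: le_trans (sum_Bnk_prefix_le nN kN (word_sup_ge0 W)) _.
  by rewrite -[leRHS]mule1; apply: lee_wpmul2l => //; rewrite lee_fin mulr_ge0.
Qed.

End CombinatorialTest.

(** * Equivalence of the two universal tests *)

Theorem theorem7 (R : realType) (b : seq bool -> \bar R) (tB : Omega -> \bar R)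
    (hb : universal_combinatorial_bernoulli_test b)
    (htB : universal_bernoulli_test tB) :
  exists c : R, 0 < c /\
    forall w : Omega,
      ((c^-1)%:E * tB w <= extend b w)%E /\ (extend b w <= c%:E * tB w)%E.
Proof.
have [cb bmax] := hb; have [tBt tmax] := htB.
have [c1 [c1_gt0 le1]] := tmax _ (extend_bernoulli_test cb).
have [f [cf tf]] := combinatorial_of_bernoulli_test tBt.
have [c2 [c2_gt0 le2]] := bmax f cf.
have e0 w : (0 <= extend b w)%E by apply: extend_ge0; case: cb.
have tB0 w : (0 <= tB w)%E by case: tBt.
(* The 2 undoes the halving in [f], and [c2] comes from the universality of [b]. *)
have le3 w : (tB w <= (2 * c2)%:E * extend b w)%E.
  apply: (le_trans (tf w)); rewrite EFinM -muleA; apply: lee_wpmul2l => //.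
  rewrite extendE; apply: ge_ereal_sup => _ [n _ <-]; apply: (le_trans (le2 _)).
  by apply: lee_wpmul2l; [rewrite lee_fin ltW|exact: le_extend].
(* The sum dominates both constants; since both tests are nonnegative, enlarging a constant keeps
   its inequality. *)
have c_gt0 : 0 < c1 + 2 * c2 by lra.
exists (c1 + 2 * c2); split=> // w; split.
  rewrite lee_pdivrMl//; apply: (le_trans (le3 w)).
  by apply: lee_wpmul2r => //; rewrite lee_fin; lra.
apply: (le_trans (le1 w)); apply: lee_wpmul2r => //; rewrite lee_fin; lra.
Qed.
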